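(* Let $\Omega$ be a sample space, let $\mathcal{C}\subset\mathcal{P}(\Omega)$ be a field on $\Omega$, and let $P:\mathcal{C}\to\mathbb{R}$ be a price assignment. Then $P$ is system-3-coherent if and only if $P$ is a countably additive probability and $\Omega$ admits a finite partition into $\mathcal{C}$-measurable atoms (that is, a finite partition each of whose members belongs to $\mathcal{C}$ and is an atom).
   Context: $\mathcal{C}$ is the set of events for which prices are assigned; a price assignment is a function $P:\mathcal{C}\to\mathbb{R}$. $I_A$ denotes the indicator function of $A\subset\Omega$, and $\mathbb{Z}^{+}=\{1,2,3,\ldots\}$. A betting portfolio is a sequence $(\alpha_i,A_i)_{i\in\mathbb{Z}^{+}}$ with $\alpha_i\in\mathbb{R}$ and $A_i\in\mathcal{C}$. Its price is $\sum_{i=1}^{\infty}\alpha_iP(A_i)$ and its balance is $\sum_{i=1}^{\infty}\alpha_i(I_{A_i}-P(A_i))$. A betting system is a collection of betting portfolios. Betting system 3 (for given $(\Omega,\mathcal{C},P)$) consists of exactly those betting portfolios $(\alpha_i,A_i)_{i\in\mathbb{Z}^{+}}$ such that $\sum_{i=1}^{\infty}\alpha_iP(A_i)$ converges and $\sum_{i=1}^{\infty}\alpha_i(I_{A_i}-P(A_i))$ converges pointwise on $\Omega$ (convergence is in the given order and need not be absolute). $P$ is incoherent in a given betting system if there exist a betting portfolio $(\alpha_i,A_i)_{i\in\mathbb{Z}^{+}}$ in that system and $\epsilon>0$ such that for all $w\in\Omega$, $\sum_{i=1}^{\infty}\alpha_i(I_{A_i}(w)-P(A_i))\le-\epsilon$.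 $P$ is coherent in the system if it is not incoherent in it; system-3-coherent means coherent in betting system 3. For a field $\mathcal{C}$, $P$ is a finitely additive probability if $0\le P(A)\le 1$ for all $A\in\mathcal{C}$, $P(\Omega)=1$, and $P(A\cup B)=P(A)+P(B)$ for all disjoint $A,B\in\mathcal{C}$. $P$ is a countably additive probability if in addition, for every sequence $(A_i)_{i\ge1}$ of disjoint sets in $\mathcal{C}$ with $\bigcup_{i\ge1}A_i\in\mathcal{C}$, $P(\bigcup_{i\ge1}A_i)=\sum_{i=1}^{\infty}P(A_i)$. $A\in\mathcal{C}$ is an atom if $P(A)>0$ and for every $B\in\mathcal{C}$ with $B\subset A$, $P(B)=P(A)$ or $P(B)=0$. *)

(* Defs.v *)
From mathcomp Require Import all_boot all_order all_algebra.
From mathcomp Require Import all_classical all_reals all_analysis.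

Set Implicit Arguments.
Unset Strict Implicit.
Unset Printing Implicit Defensive.

Import Order.TTheory GRing.Theory Num.Theory.
Import numFieldNormedType.Exports.

Local Open Scope classical_set_scope.
Local Open Scope ring_scope.

(* A price assignment C -> R is represented by a total function
   P : set T -> R. Every notion below evaluates P on members of C only, so
   its values outside C are irrelevant. *)

Definition field_of_sets (T : Type) (C : set (set T)) : Prop :=
  [/\ C setT, setC_closed C & setU_closed C].

Section Betting.
Context {T : Type} {R : realType}.
Implicit Types (C : set (set T)) (P : set T -> R).
Implicit Types (b : nat -> R * set T) (S : set (nat -> R * set T)).

(* Sequences are indexed from 0 instead of 1. *)
Definition betting_portfolio C b : Prop := forall i, C (b i).2.

Definition price_term P b (i : nat) : R := (b i).1 * P (b i).2.

Definition balance_term P b (w : T) (i : nat) : R :=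
  (b i).1 * (\1_((b i).2) w - P (b i).2).

(* The value [limn (series _)] is meaningful only when the balance converges
   at w, as it does for the portfolios of [betting_system3]. *)
Definition balance P b (w : T) : R := limn (series (balance_term P b w)).

Definition betting_system3 C P : set (nat -> R * set T) :=
  [set b | [/\ betting_portfolio C b,
               cvgn (series (price_term P b)) &
               forall w : T, cvgn (series (balance_term P b w))]].

Definition incoherent P S : Prop :=
  exists b, S b /\
    exists eps : R, 0 < eps /\ forall w : T, balance P b w <= - eps.

Definition coherent P S : Prop := ~ incoherent P S.

Definition system3_coherent C P : Prop := coherent P (betting_system3 C P).

Definition finitely_additive_probability C P : Prop :=
  [/\ forall A, C A -> 0 <= P A <= 1,
      P setT = 1 &
      forall A B, C A -> C B -> A `&` B = set0 -> P (A `|` B) = P A + P B].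

Definition countably_additive_probability C P : Prop :=
  finitely_additive_probability C P /\
  forall A : nat -> set T, (forall i, C (A i)) -> trivIset setT A ->
    C (\bigcup_i A i) ->
    series (fun i => P (A i)) @ \oo --> P (\bigcup_i A i).

Definition atom C P (A : set T) : Prop :=
  [/\ C A, 0 < P A &
      forall B, C B -> B `<=` A -> P B = P A \/ P B = 0].

Definition finite_atomic_partition C P (F : set (set T)) : Prop :=
  [/\ finite_set F, partition F id [set: T] & forall A, F A -> atom C P A].

End Betting.

(* Main.v *)
Require Import Defs.
From mathcomp Require Import all_boot all_order all_algebra.
From mathcomp Require Import all_classical all_reals all_analysis.
From mathcomp Require Import ring lra.

(** If P is a countably additive probability and Omega splits into finitely many
    atoms, then each A in C meets an atom X in a null set or in almost all of
    X. A portfolio involves only countably many sets, and by countable additivity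
    countably many null sets do not cover X. So X contains a point w_X at which
    every set A_i of the portfolio has the indicator value P(A_i & X) / P(X).
    Each single bet then has average 0 over the points w_X with weights P(X), so
    the balance, being a pointwise limit, also has average 0 and cannot be at
    most - eps at all the points w_X. This is [finitely_atomic_coherent].

    Conversely, let P be coherent. Bets on at most three sets give the axioms of
    a finitely additive probability. If disjoint sets A_i have prices whose sum
    differs from the price of their union, a stake c on every A_i and - c on the
    union pay 0 everywhere and have a nonzero price
    ([coherent_countably_additive]). If Omega has no finite partition into
    atoms, non-atomic remainders can be split forever, which gives disjoint sets
    B_0, B_1, ... of positive price
    ([disjoint_positive_of_not_finitely_atomic]). Then

      1 - 1/2 + 1/3 - 1/4 + ... > 0,

    while, for every odd m, the terms of this series whose index k has odd part
    m sum to 1/m - (1/(2m) + 1/(4m) + ...) = 0. So put on B_m, with m the odd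
    part of k, a stake that costs (-1)^(k+1)/k, for k = 1, 2, .... The price is a
    positive number, but the payoff is 0 at every point: at most one B_m contains
    the point, and its bets cancel ([coherent_no_disjoint_positive]). The
    conditional convergence of the price is what makes this possible. *)

Set Implicit Arguments.
Unset Strict Implicit.
Unset Printing Implicit Defensive.

Import Order.TTheory GRing.Theory Num.Theory.
Import numFieldNormedType.Exports.

Local Open Scope classical_set_scope.
Local Open Scope ring_scope.

(** * Alternating series *)

Section AlternatingSums.
Context {R : realType}.
Implicit Types (f g u : nat -> R) (c l : R).

Lemma sign_double n : (-1) ^+ n.*2 = 1 :> R.
Proof. by rewrite -signr_odd odd_double. Qed.

Lemma cvg_double : double @ \oo --> \oo.
Proof.
rewrite (_ : double = muln^~ 2%N); first exact: cvg_mulnr.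
by apply/funext => n; rewrite muln2.
Qed.

Lemma series_cvg_even u l : u @ \oo --> 0 ->
  (fun n => series u n.*2) @ \oo --> l -> series u @ \oo --> l.
Proof.
move=> u0 ul.
have half_infty : half @ \oo --> \oo.
  apply/cvgnyPge => A; near=> n.
  have : (A.*2 <= n)%N by near: n; exact: nbhs_infty_ge.
  by move=> An; rewrite -[A]doubleK half_leq.
have -> : series u =
    fun n => series u n./2.*2 + (odd n)%:R * u n./2.*2.
  apply/funext => n; rewrite -{1}(odd_double_half n).
  by case: (odd n); rewrite ?add1n ?add0n ?seriesSr ?mul1r // mul0r addr0.
rewrite -[l in X in _ --> X]addr0; apply: cvgD.
  exact: (cvg_comp _ _ half_infty ul).
apply/norm_cvg0P.
have udbl : (fun n => `|u n./2.*2|) @ \oo --> 0.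
  apply/norm_cvg0P.
  exact: (cvg_comp _ _ half_infty (cvg_comp _ _ cvg_double u0)).
apply: (squeeze_cvgr _ (cvg_cst 0) udbl); near=> n.
rewrite normr_ge0/= normrM; case: (odd n); rewrite ?normr1 ?mul1r//.
by rewrite normr0 mul0r.
Unshelve. all: by end_near. Qed.

Lemma cvg_alternating_terms f : f @ \oo --> 0 ->
  (fun i => (-1) ^+ i * f i) @ \oo --> 0.
Proof.
move=> f0; apply/norm_cvg0P; under eq_fun => i.
  rewrite normrM normrX normrN1 expr1n mul1r; over.
exact/norm_cvg0P.
Qed.

(** The sum of the first two terms is the lower bound that makes the limit of
    the alternating harmonic series visibly positive. *)
Lemma leibniz_test f : nonincreasing_seq f -> f @ \oo --> 0 ->
  exists2 l, f 0%N - f 1%N <= l & series (fun i => (-1) ^+ i * f i) @ \oo --> l.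
Proof.
move=> nf f0; pose a n := series (fun i => (-1) ^+ i * f i) n.*2.
have aS n : a n.+1 = a n + (f n.*2 - f n.*2.+1).
  rewrite /a doubleS !seriesSr !exprS sign_double; ring.
have a0 : a 0%N = 0 by rewrite /a /series /= big_geq.
have nda : nondecreasing_seq a.
  by apply/nondecreasing_seqP => n; rewrite aS lerDl subr_ge0 nf.
have a_ub n : a n <= f 0%N - f n.*2.
  elim: n => [|n IH]; first by rewrite a0 subrr.
  have : f n.*2.+2 <= f n.*2.+1 by apply: nf.
  by rewrite aS doubleS; lra.
have f_ge0 n : 0 <= f n.
  by rewrite -(cvg_lim _ f0)//; apply: nonincreasing_cvgn_ge => //; exact: cvgP f0.
have ca : cvgn a.
  apply: nondecreasing_is_cvgn => //; exists (f 0%N) => _ [n _ <-].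
  by rewrite (le_trans (a_ub n))// lerBlDr lerDl f_ge0.
exists (limn a); last first.
  by apply: series_cvg_even => //; exact: cvg_alternating_terms.
have <- : a 1%N = f 0%N - f 1%N by rewrite aS a0 add0r.
exact: nondecreasing_cvgn_le.
Qed.

Lemma alternating_harmonic_cvg :
  exists2 l : R, 0 < l & series (fun i => (-1) ^+ i * i.+1%:R^-1) @ \oo --> l.
Proof.
have [||l hl cl] := @leibniz_test (@harmonic R).
- apply/nonincreasing_seqP => n.
  by rewrite /harmonic lef_pV2 ?posrE ?ltr0n// ler_nat.
- exact: cvg_harmonic.
exists l => //; apply: lt_le_trans hl; rewrite /harmonic/= invr1; lra.
Qed.

(** An alternating sum is the full sum minus twice the sum over even indices, and
    the homogeneity of f turns the latter into the full sum over the first half.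
    When the series of f converges, the alternating series therefore tends
    to 0. *)
Lemma alternating_series_even f n : (forall k, f k.*2 = f k / 2) ->
  series (fun i => (-1) ^+ i * f i.+1) n.*2 =
  series (fun i => f i.+1) n.*2 - series (fun i => f i.+1) n.
Proof.
move=> fdbl; elim: n => [|n IH].
  by rewrite /series /= double0 !big_geq// subrr.
rewrite doubleS !seriesSr IH !exprS sign_double.
have := fdbl n.+1; rewrite doubleS => ->.
by field.
Qed.

Definition odd_part (k : nat) : nat := partn k (negn 2%N).

Lemma odd_part_double k : odd_part k.*2 = odd_part k.
Proof.
case: k => [//|k]; rewrite /odd_part -muln2 partnM//.
by rewrite (@part_p'nat _ 2) ?muln1// pnatNK pnat_id.
Qed.

Lemma odd_part_odd k : odd k -> odd_part k = k.
Proof. by move=> ok; rewrite /odd_part part_pnat_id// -odd_2'nat. Qed.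

(** For g the indicator of an odd m this is the identity
    1/m - 1/(2m) - 1/(4m) - ... = 0. In general, the terms
    f k = g (odd_part k) / k satisfy f (2k) = f k / 2, so by
    [alternating_series_even] it suffices that their series converges. *)
Lemma alternating_odd_part_cvg0 g c : (forall m, 0 <= g m) ->
  (forall n, series g n <= c) ->
  series (fun i => (-1) ^+ i * (g (odd_part i.+1) / i.+1%:R)) @ \oo --> 0.
Proof.
move=> g0 gc; pose f k := g (odd_part k) / k%:R.
have f0 k : 0 <= f k by rewrite divr_ge0.
have fdbl k : f k.*2 = f k / 2.
  by rewrite /f odd_part_double -muln2 natrM invfM mulrA.
pose F := series (fun i => f i.+1).
have ndF : nondecreasing_seq F.
  by apply/nondecreasing_seqP => n; rewrite /F seriesSr lerDl.
(* Even indices contribute half of the sum up to n, hence at most half of the sum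
   up to 2n: this bounds F by twice the contribution of the odd indices. *)
have F_odd n : F n.*2 = series (fun i => f i.*2.+1) n + F n / 2.
  rewrite /F; elim: n => [|n IH]; first by rewrite /series /= !big_geq// mul0r addr0.
  by rewrite doubleS !seriesSr IH -doubleS fdbl; field.
have odd_ub n : series (fun i => f i.*2.+1) n <= series g n.*2.
  elim: n => [|n IH]; first by rewrite /series /= !big_geq.
  rewrite doubleS !seriesSr -addrA lerD//.
  rewrite /f odd_part_odd/= ?odd_double//.
  rewrite -[leLHS]add0r lerD// ler_pdivrMr ?ltr0n// ler_peMr//.
  by rewrite ler1n.
have Fub n : F n <= 2 * c.
  have := le_trans (odd_ub n) (gc _).
  have : F n <= F n.*2 by apply: ndF; rewrite -addnn leq_addr.
  by rewrite F_odd; lra.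
have cF : cvgn F.
  by apply: nondecreasing_is_cvgn => //; exists (2 * c) => _ [n _ <-].
apply: series_cvg_even.
  apply: cvg_alternating_terms.
  by apply: cvg_series_cvg_0.
under eq_fun => n do rewrite (alternating_series_even _ fdbl).
rewrite -(subrr (limn F)); apply: cvgB => //.
exact: (cvg_comp _ _ cvg_double cF).
Qed.

End AlternatingSums.

(** * Finitely additive probabilities on a field *)

Section FieldOfSets.
Context {T : Type} {C : set (set T)} (hC : field_of_sets C).

Lemma field_set0 : C set0.
Proof. by case: hC => CT CC _; rewrite -setCT; exact: CC. Qed.

Lemma field_setI A B : C A -> C B -> C (A `&` B).
Proof.
case: hC => _ CC CU CA CB; rewrite -[A `&` B]setCK setCI.
by apply: (CC); apply: CU; exact: (CC).
Qed.

Lemma field_setD A B : C A -> C B -> C (A `\` B).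
Proof. by case: hC => _ CC _ CA CB; rewrite setDE; apply: field_setI => //; exact: CC. Qed.

Lemma field_bigsetU I (r : seq I) (p : pred I) (F : I -> set T) :
  (forall i, C (F i)) -> C (\big[setU/set0]_(i <- r | p i) F i).
Proof.
case: hC => _ _ CU CF; elim/big_ind: _ => //; exact: field_set0.
Qed.

Lemma field_seqDU (F : nat -> set T) n : (forall i, C (F i)) -> C (seqDU F n).
Proof. by move=> CF; apply: field_setD => //; exact: field_bigsetU. Qed.

End FieldOfSets.

Section FiniteAdditivity.
Context {T : Type} {R : realType} {C : set (set T)} {P : set T -> R}.
Context (hC : field_of_sets C) (hP : finitely_additive_probability C P).

Lemma fap_ge0 A : C A -> 0 <= P A.
Proof. by case: hP => P01 _ _ /P01 /andP[]. Qed.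

Lemma fap_set0 : P set0 = 0.
Proof.
case: hP => _ _ PU; have C0 := field_set0 hC.
by have := PU _ _ C0 C0 (setI0 _); rewrite setU0; lra.
Qed.

Lemma fap_split A B : C A -> C B -> P A = P (A `&` B) + P (A `\` B).
Proof.
case: hP => _ _ PU CA CB; rewrite -PU ?setUIDK//.
- exact: field_setI.
- exact: field_setD.
- by rewrite setDE setIACA setICr setI0.
Qed.

Lemma fap_subset A B : C A -> C B -> A `<=` B -> P A <= P B.
Proof.
move=> CA CB AB; rewrite (fap_split CB CA) (setIidr AB) lerDl.
by apply: fap_ge0; exact: field_setD.
Qed.

Lemma fap_sum_ord (A : nat -> set T) n : (forall i, C (A i)) ->
  trivIset setT A -> P (\big[setU/set0]_(i < n) A i) = series (fun i => P (A i)) n.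
Proof.
case: hP => _ _ PU CA tA; elim: n => [|n IH].
  by rewrite big_ord0 fap_set0 /series /= big_geq.
rewrite big_ord_recr seriesSr -IH PU//; first exact: field_bigsetU.
rewrite -bigcup_mkord setI_bigcupl bigcup0// => i /= ilt.
by have /trivIsetP/(_ i n I I) := tA; apply; rewrite ltn_eqF.
Qed.

Lemma fap_sum_seq (s : seq (set T)) A : uniq s -> trivIset [set` s] id ->
  (forall X, X \in s -> C X) -> C A ->
  P (A `&` \bigcup_(X in [set` s]) X) = \sum_(X <- s) P (A `&` X).
Proof.
case: hP => _ _ PU + + + CA; elim: s => [|X s IH] /=.
  by move=> *; rewrite set_nil bigcup_set0 setI0 big_nil fap_set0.
move=> /andP[Xs us] tXs CXs.
have Cs Y : Y \in s -> C Y by move=> Ys; apply: CXs; rewrite inE Ys orbT.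
have CX : C X by apply: CXs; rewrite mem_head.
have CU : C (\bigcup_(Y in [set` s]) Y).
  rewrite bigcup_seq big_seq; elim/big_ind: _ => //; first exact: field_set0.
  by case: hC.
rewrite big_cons -IH//; last first.
  by apply: sub_trivIset tXs => Y /= Ys; rewrite inE Ys orbT.
rewrite bigcup_seq big_cons -bigcup_seq setIUr PU//; try exact: field_setI.
rewrite setIACA setIid setI_bigcupr bigcup0 ?setI0// => Y /= Ys.
apply: contrapT => /eqP/set0P XY.
have := tXs X Y; rewrite /= mem_head inE Ys orbT => /(_ isT isT XY) XYE.
by move: Xs; rewrite XYE Ys.
Qed.

End FiniteAdditivity.

(** * Consequences of coherence *)

Section Coherence.
Context {T : Type} {R : realType} {C : set (set T)} {P : set T -> R}.
Implicit Types (b : nat -> R * set T) (s : seq (R * set T)).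

(** Separating payoff from price lets every book below be given by two easier
    series. *)
Lemma coherent_no_arbitrage b (p : R) (g : T -> R) : system3_coherent C P ->
  betting_portfolio C b -> series (price_term P b) @ \oo --> p ->
  (forall w, series (fun i => (b i).1 * \1_((b i).2) w) @ \oo --> g w) ->
  forall eps, 0 < eps -> ~ forall w, g w <= p - eps.
Proof.
move=> coh Cb bp bg eps eps0 gp; apply: coh.
have balE w : series (balance_term P b w) @ \oo --> g w - p.
  have -> : series (balance_term P b w) =
      series (fun i => (b i).1 * \1_((b i).2) w) - series (price_term P b).
    apply/funext => n; rewrite /series /= !fctE -sumrB.
    by apply: eq_bigr => i _; rewrite /balance_term /price_term mulrBr.
  exact: cvgB.
exists b; split; first by split=> //; [exact: cvgP bp | move=> w; exact: cvgP (balE w)].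
exists eps; split=> // w; rewrite /balance (cvg_lim _ (balE w))//.
by have := gp w; lra.
Qed.

Lemma series_cvg_cons (u : nat -> R) (l : R) :
  series (fun i => u i.+1) @ \oo --> l -> series u @ \oo --> u 0%N + l.
Proof.
move=> ul; rewrite -cvg_shiftS.
under eq_fun => n do rewrite /series /= big_nat_recl//.
by apply: cvgD => //; exact: cvg_cst.
Qed.

Lemma series_cvg_nth (E : Type) (d : E) (f : E -> R) (r : seq E) : f d = 0 ->
  series (fun i => f (nth d r i)) @ \oo --> \sum_(x <- r) f x.
Proof.
move=> fd; elim: r => [|x r IH]; last by rewrite big_cons; exact: series_cvg_cons.
rewrite big_nil; apply: cvg_near_cst; near=> n.
by rewrite /series /= big1// => i _; rewrite nth_nil.
Unshelve. all: by end_near. Qed.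

(** A finite list of bets becomes a portfolio by appending bets with stake 0. *)
Lemma coherent_no_finite_arbitrage s eps : system3_coherent C P -> C setT ->
  (forall x, List.In x s -> C x.2) -> 0 < eps ->
  ~ forall w, \sum_(x <- s) x.1 * \1_(x.2) w <= \sum_(x <- s) x.1 * P x.2 - eps.
Proof.
move=> coh CT Cs eps0 arb.
apply: (@coherent_no_arbitrage (nth (0, setT) s) _ _ coh _ _ _ _ eps0 arb).
- elim: s Cs {arb} => [|x s IH] Cs [|i] //=; first by apply: Cs; left.
  by apply: IH => y sy; apply: Cs; right.
- by apply: (@series_cvg_nth _ (0, setT) (fun x => x.1 * P x.2)); rewrite mul0r.
- move=> w.
  by apply: (@series_cvg_nth _ (0, setT) (fun x => x.1 * \1_(x.2) w)); rewrite mul0r.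
Qed.

Context (hC : field_of_sets C) (coh : system3_coherent C P).

Lemma coherent_finitely_additive : finitely_additive_probability C P.
Proof.
have [CT _ CU] := hC.
have noarb1 (a eps : R) A : C A -> 0 < eps ->
    ~ forall w, a * \1_A w <= a * P A - eps.
  move=> CA eps0 arb.
  apply: (@coherent_no_finite_arbitrage [:: (a, A)] _ coh CT _ eps0).
    by move=> x [<-|[]].
  by move=> w; rewrite !big_seq1.
split.
- move=> A CA; have ind w : 0 <= (\1_A w : R) <= 1.
    by rewrite indicE; case: (_ \in _); rewrite lexx ler01.
  apply/andP; split; rewrite leNgt; apply/negP => PA.
    apply: (noarb1 (-1) (- P A) A) => //; first by rewrite oppr_gt0.
    by move=> w; have := ind w; lra.
  apply: (noarb1 1 (P A - 1) A) => //; first by rewrite subr_gt0.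
  by move=> w; have := ind w; lra.
- apply: contrapT => /eqP PT.
  (* A sure event at the wrong price: the sign of the stake makes the loss
     (P setT - 1) ^+ 2. *)
  apply: (noarb1 (P setT - 1) ((P setT - 1) ^+ 2) setT) => //.
    by rewrite exprn_even_gt0//= subr_eq0.
  by move=> w; rewrite indicT /=; lra.
- move=> A B CA CB AB0; apply: contrapT => /eqP PAB.
  (* The stakes c, c and - c on A, B and their union pay 0 and cost c ^+ 2. *)
  pose c := P A + P B - P (A `|` B).
  apply: (@coherent_no_finite_arbitrage
    [:: (c, A); (c, B); (- c, A `|` B)] (c ^+ 2)) => //.
  + by move=> x [<-|[<-|[<-|[]]]] //=; exact: CU.
  + by rewrite exprn_even_gt0//= subr_eq0 eq_sym.
  move=> w; rewrite !big_cons !big_nil/= !indicE in_setU.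
  suff : ~~ ((w \in A) && (w \in B)).
    by rewrite /c; case: (w \in A); case: (w \in B) => //= _; lra.
  by rewrite -in_setI AB0 in_set0.
Qed.

Lemma indic_bigcup_series (A : nat -> set T) w : trivIset setT A ->
  series (fun i => \1_(A i) w) @ \oo --> (\1_(\bigcup_i A i) w : R).
Proof.
move=> tA; have [[m _ Amw]|nA] := pselect ((\bigcup_i A i) w); last first.
  rewrite indicE memNset//; apply: cvg_near_cst; near=> n.
  rewrite /series /= big1// => i _; rewrite indicE memNset// => Aiw.
  by apply: nA; exists i.
rewrite indicE mem_set; last by exists m.
apply: cvg_near_cst; near=> n.
have mn : (m < n)%N by near: n; exact: nbhs_infty_gt.
rewrite /series /= big_mkord (bigD1 (Ordinal mn))//= indicE mem_set// big1 ?addr0//.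
move=> i im; rewrite indicE memNset// => Aiw.
have : (i : nat) = m by apply: tA => //; exists w.
by move=> imE; move: im; rewrite -val_eqE/= imE eqxx.
Unshelve. all: by end_near. Qed.

(** The price series converges in any case, since its partial sums are prices of
    finite unions; so the book below is admissible whatever its limit is. *)
Lemma coherent_countably_additive : countably_additive_probability C P.
Proof.
have hP := coherent_finitely_additive; split=> // A CA tA CUA.
have Pub n : series (fun i => P (A i)) n <= 1.
  rewrite -(fap_sum_ord hC hP _ CA tA).
  have [P01 _ _] := hP; set U := \big[setU/set0]_(i < n) A i.
  by have /P01/andP[] : C U by exact: field_bigsetU.
have cPA : cvgn (series (fun i => P (A i))).
  apply: nondecreasing_is_cvgn; last by exists 1 => _ [n _ <-].
  by apply/nondecreasing_seqP => n; rewrite seriesSr lerDl (fap_ge0 hP).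
suff <- : limn (series (fun i => P (A i))) = P (\bigcup_i A i) by [].
apply: contrapT => /eqP PA.
set l := limn _ in PA; pose c := l - P (\bigcup_i A i).
(* The book pays 0 and costs c * (l - P (\bigcup_i A i)) = c ^+ 2. *)
pose b i := if i is j.+1 then (c, A j) else (- c, \bigcup_i A i).
apply: (@coherent_no_arbitrage b (c ^+ 2) (fun=> 0) coh _ _ _ (c ^+ 2)).
- by case.
- have -> : c ^+ 2 = price_term P b 0 + c * l by rewrite /price_term /= /c; ring.
  apply: series_cvg_cons; rewrite /price_term/=.
  rewrite (_ : series _ = (fun n => c * series (fun i => P (A i)) n)).
    exact: cvgMl_tmp.
  by apply/funext => n; rewrite /series /= mulr_sumr.
- move=> w.
  have -> : 0 = (b 0%N).1 * \1_((b 0%N).2) w + c * \1_(\bigcup_i A i) w.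
    by rewrite /= mulNr addNr.
  apply: (@series_cvg_cons (fun i => (b i).1 * \1_((b i).2) w)) => /=.
  rewrite (_ : series _ = (fun n => c * series (fun i => \1_(A i) w) n)).
    by apply: cvgMl_tmp; exact: indic_bigcup_series.
  by apply/funext => n; rewrite /series /= mulr_sumr.
- by rewrite exprn_even_gt0//= subr_eq0.
- by move=> w; rewrite subrr.
Qed.

(** Dividing the stakes by P (B m) makes the costs the terms of the alternating
    harmonic series, whatever the sizes of the sets. *)
Lemma coherent_no_disjoint_positive (B : nat -> set T) : (forall m, C (B m)) ->
  (forall m, 0 < P (B m)) -> ~ trivIset setT B.
Proof.
move=> CB PB tB; have [l l0 hl] := @alternating_harmonic_cvg R.
pose b i := ((-1) ^+ i * (i.+1%:R^-1 / P (B (odd_part i.+1))),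
             B (odd_part i.+1)).
apply: (@coherent_no_arbitrage b l (fun=> 0) coh _ _ _ l l0).
- by move=> i; exact: CB.
- rewrite (_ : price_term P b = fun i => (-1) ^+ i * i.+1%:R^-1)//.
  by apply/funext => i; rewrite /price_term/= mulrA mulfVK// gt_eqF.
- move=> w; pose g m := \1_(B m) w / P (B m).
  rewrite (_ : (fun i => _) = fun i => (-1) ^+ i * (g (odd_part i.+1) / i.+1%:R)).
    have g0 m : 0 <= g m by rewrite divr_ge0// ltW.
    have [[m _ Bmw]|nB] := pselect ((\bigcup_i B i) w).
      apply: (@alternating_odd_part_cvg0 _ g (g m)) => // n.
      have gE k : g k = if k == m then g m else 0.
        case: eqP => [->//|km]; rewrite /g indicE memNset ?mul0r// => Bkw.
        by apply: km; apply: tB => //; exists w.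
      rewrite /series /=; under eq_bigr do rewrite gE.
      by rewrite -big_mkcond big_nat1_eq; case: ifP.
    apply: (@alternating_odd_part_cvg0 _ g 0) => // n.
    rewrite /series /= big1// => i _; rewrite /g indicE memNset ?mul0r//.
    by move=> Biw; apply: nB; exists i.
  by apply/funext => i /=; rewrite /g; ring.
- by move=> w; rewrite subrr.
Qed.

End Coherence.

(** * Splitting off sets of positive probability *)

Section FinitelyAtomic.
Context {T : Type} {R : realType} (C : set (set T)) (P : set T -> R).

(** [finite_atomic_partition] relativized to a set D, so that it can be tested on
    the pieces of a set that is being split. *)
Definition finitely_atomic (D : set T) : Prop := exists F : set (set T),
  [/\ finite_set F, partition F id D & forall A, F A -> atom C P A].

Lemma finitely_atomicU A B : A `&` B = set0 ->
  finitely_atomic A -> finitely_atomic B -> finitely_atomic (A `|` B).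
Proof.
move=> AB0 [F [Ff [FA tF F0] Fat]] [G [Gf [GB tG G0] Gat]].
exists (F `|` G); split; last by move=> X [/Fat|/Gat].
  by rewrite finite_setU.
split; last by move=> X [/F0|/G0].
  by rewrite /cover bigcup_setU; congr (_ `|` _).
have disj X Y : F X -> G Y -> X `&` Y !=set0 -> X = Y.
  move=> FX GY [w [Xw Yw]].
  suff : set0 w by [].
  by rewrite -AB0 -FA -GB; split; [exists X | exists Y].
move=> X Y [FX|GX] [FY|GY] XY.
- exact: tF.
- exact: disj.
- by apply/esym/disj; rewrite // setIC.
- exact: tG.
Qed.

Lemma atom_finitely_atomic A : P set0 = 0 -> atom C P A -> finitely_atomic A.
Proof.
move=> P0 atA; exists [set A]; split; [exact: finite_set1 | | by move=> _ ->].
split; first by rewrite /cover bigcup_set1.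
- by move=> _ _ -> ->.
- move=> _ ->; apply/set0P/eqP => A0; case: atA => _ + _.
  by rewrite A0 P0 ltxx.
Qed.
End FinitelyAtomic.

Section Peeling.
Context {T : Type} {R : realType} {C : set (set T)} {P : set T -> R}.
Context (hC : field_of_sets C) (hP : finitely_additive_probability C P).

(** D is not an atom, so some B splits it into two parts of positive probability,
    and by [finitely_atomicU] one of the parts is again not finitely atomic: keep
    that part and release the other one. *)
Lemma not_finitely_atomic_peel D : C D -> 0 < P D -> ~ finitely_atomic C P D ->
  exists E, [/\ C E, 0 < P E, ~ finitely_atomic C P E, E `<=` D & 0 < P (D `\` E)].
Proof.
move=> CD PD nD.
have [B [CB BD PB0 PBD]] : exists B, [/\ C B, B `<=` D, P B != 0 & P B != P D].
  apply: contrapT => nB; apply: nD; apply: atom_finitely_atomic.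
    exact: (fap_set0 hC hP).
  split=> // B CB BD; have [->|PB0] := eqVneq (P B) 0; first by right.
  by left; apply: contrapT => /eqP PBD; apply: nB; exists B.
have CDB := field_setD hC CD CB.
have PDE := fap_split hC hP CD CB; rewrite (setIidr BD) in PDE.
have PB : 0 < P B by rewrite lt_neqAle eq_sym PB0 (fap_ge0 hP).
have PDB : 0 < P (D `\` B).
  rewrite lt_neqAle (fap_ge0 hP CDB) andbT; apply: contra PBD => /eqP PDB0.
  by rewrite PDE -PDB0 addr0.
have [nB|aB] := pselect (~ finitely_atomic C P B); first by exists B.
exists (D `\` B); split=> //.
- move=> aDB; apply: nD; rewrite -(setUIDK D B) (setIidr BD).
  apply: finitely_atomicU => //; last exact: contrapT.
  by rewrite setDE setICA setICr setI0.
- by rewrite setDD (setIidr BD).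
Qed.

Lemma disjoint_positive_of_not_finitely_atomic : ~ finitely_atomic C P setT ->
  exists B : nat -> set T,
    [/\ forall m, C (B m), forall m, 0 < P (B m) & trivIset setT B].
Proof.
move=> nT; have [CT _ _] := hC; have [_ PT _] := hP.
pose big D := [/\ C D, 0 < P D & ~ finitely_atomic C P D].
have bigT : big setT by split=> //; rewrite PT.
have next (D : {D | big D}) :
    exists E : {D | big D}, sval E `<=` sval D /\ 0 < P (sval D `\` sval E).
  case: D => D [CD PD nD] /=.
  have [E [CE PE nE ED PDE]] := not_finitely_atomic_peel CD PD nD.
  by exists (exist _ E (And3 CE PE nE)).
have [f fP] := choice next.
pose D n := sval (iter n f (exist _ setT bigT)).
have CD n : C (D n) by case: (svalP (iter n f (exist _ setT bigT))).
have Dsub m n : (m <= n)%N -> D n `<=` D m.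
  move=> /subnK <-; elim: (n - m)%N => [//|k IH].
  apply: subset_trans IH; rewrite addSn; exact: (fP _).1.
exists (fun n => D n `\` D n.+1); split=> [m|m|].
- exact: field_setD.
- exact: (fP _).2.
- have lt_disj m n w : (m < n)%N -> (D m `\` D m.+1) w -> ~ (D n `\` D n.+1) w.
    by move=> mn [_ nDm] [Dn _]; apply: nDm; exact: Dsub Dn.
  move=> m n _ _ [w [Bm Bn]]; case: (ltngtP m n) => // mn.
  + by case: (lt_disj _ _ _ mn Bm Bn).
  + by case: (lt_disj _ _ _ mn Bn Bm).
Qed.
End Peeling.

(** * Coherence from a finite atomic partition *)

Section AtomicCoherence.
Context {T : Type} {R : realType} {C : set (set T)} {P : set T -> R}.
Context (hC : field_of_sets C) (hP : countably_additive_probability C P).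

(** Countable additivity is applied to the disjointed sets: each of them is built
    from finitely many members of the field, hence belongs to it. *)
Lemma null_cover (E : nat -> set T) : (forall i, C (E i)) ->
  (forall i, P (E i) = 0) -> C (\bigcup_i E i) -> P (\bigcup_i E i) = 0.
Proof.
case: hP => fP cP CE E0; rewrite seqDU_bigcup_eq => CU.
have CD i := field_seqDU hC i CE.
have D0 i : P (seqDU E i) = 0.
  apply/eqP; rewrite eq_le (fap_ge0 fP (CD i)) andbT -(E0 i).
  by apply: (fap_subset hC fP) => //; exact: subDsetl.
have := cP _ CD (trivIset_seqDU E) CU.
rewrite (_ : series _ = fun=> 0); first by move/(cvg_lim _) <- => //; rewrite lim_cst.
by apply/funext => n; rewrite /series /= big1.
Qed.

(** For each i, the points of X where the indicator of A i is not the almost sure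
    one form a null set E i. These sets do not cover X, as it has positive
    probability; their union need not be in C, but if they did cover X it would
    be X itself. *)
Lemma atom_generic_point (A : nat -> set T) X : (forall i, C (A i)) ->
  atom C P X -> exists w, forall i, P X * \1_(A i) w = P (A i `&` X).
Proof.
move=> CA [CX PX atX]; have [fP _] := hP.
pose E i := if P (A i `&` X) == 0 then A i `&` X else X `\` A i.
have CE i : C (E i).
  by rewrite /E; case: ifP => _; [exact: field_setI | exact: field_setD].
have EX i : E i `<=` X by rewrite /E; case: ifP => _; [exact: subIsetr | exact: subDsetl].
have E0 i : P (E i) = 0.
  rewrite /E; case: eqP => // PAX.
  have [PAX1|//] := atX _ (field_setI hC (CA i) CX) (@subIsetr _ _ _).
  by have := fap_split hC fP CX (CA i); rewrite setIC PAX1; lra.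
have [w Xw nEw] : exists2 w, X w & forall i, ~ E i w.
  apply: contrapT => nw; suff UE : \bigcup_i E i = X.
    by have := null_cover CE E0; rewrite UE => /(_ CX) PX0; rewrite PX0 ltxx in PX.
  apply/seteqP; split=> [w [i _ /EX//]|w Xw].
  apply: contrapT => nU; apply: nw; exists w => // i Eiw; apply: nU.
  by exists i.
exists w => i; have := nEw i; rewrite /E.
case: eqP => [->|PAX] nE.
  by rewrite indicE memNset ?mulr0// => Aw; exact: nE.
have [->|//] := atX _ (field_setI hC (CA i) CX) (@subIsetr _ _ _).
rewrite indicE mem_set ?mulr1//.
by apply: contrapT => nA; exact: nE.
Qed.

(** The generic points w X of the atoms form a finite sample: weighted by P X, they
    average the indicators of the sets of the portfolio to their prices. *)
Lemma finitely_atomic_coherent : finitely_atomic C P setT -> system3_coherent C P.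
Proof.
move=> [F [/finite_seqP[s0 ->] [+ + _] atF]] [b [[Cb _ cb] [eps [eps0 loss]]]].
have [fP _] := hP; have [CT _ _] := hC; have [_ PT _] := fP.
have -> : [set` s0] = [set` undup s0].
  by apply/seteqP; split=> X /=; rewrite mem_undup.
have {}atF X : X \in undup s0 -> atom C P X by rewrite mem_undup; exact: atF.
move: (undup_uniq s0) atF; set s := undup s0 => us atF covs tFs.
have CF X : X \in s -> C X by case/atF.
have [w wP] : exists w : set T -> T, forall X, X \in s ->
    forall i, P X * \1_((b i).2) (w X) = P ((b i).2 `&` X).
  have t0 : T.
    suff /set0P/cid[] : [set: T] != set0 by [].
    by apply/eqP => T0; have := oner_neq0 R; rewrite -PT T0 (fap_set0 hC fP) eqxx.
  have /choice[w wP] : forall X, exists x, X \in s ->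
    forall i, P X * \1_((b i).2) x = P ((b i).2 `&` X).
    move=> X; case: (boolP (X \in s)) => [/atF atX|_]; last by exists t0.
    by have [x xP] := atom_generic_point Cb atX; exists x.
  by exists w => X; exact: wP.
have sumP A : C A -> \sum_(X <- s) P (A `&` X) = P A.
  move=> CA; rewrite -(fap_sum_seq hC fP)//.
  by move: covs; rewrite /cover => ->; rewrite setIT.
have sum1 : \sum_(X <- s) P X = 1.
  by rewrite -PT -(sumP _ CT); apply: eq_bigr => X _; rewrite setTI.
have avg0 n : \sum_(X <- s) P X * series (balance_term P b (w X)) n = 0.
  rewrite /series /=; under eq_bigr do rewrite mulr_sumr.
  rewrite exchange_big /= big1// => i _; rewrite /balance_term.
  rewrite (_ : \sum_(X <- s) _ =
      (b i).1 * (\sum_(X <- s) P ((b i).2 `&` X) - P (b i).2 * \sum_(X <- s) P X)).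
    by rewrite sum1 sumP//; ring.
  rewrite [X in _ - X]mulr_sumr -sumrB mulr_sumr.
  by apply: eq_big_seq => X Xs; rewrite -wP//; ring.
have avg : \sum_(X <- s) P X * balance P b (w X) = 0.
  have : (fun n => \sum_(X <- s) P X * series (balance_term P b (w X)) n) @ \oo -->
      \sum_(X <- s) P X * balance P b (w X).
    apply: cvg_big => [|X _]; first exact: add_continuous.
    by apply: cvgMl_tmp; exact: cb.
  under eq_fun do rewrite avg0.
  by move/(cvg_lim _) <- => //; rewrite lim_cst.
suff : \sum_(X <- s) P X * balance P b (w X) <= - eps by rewrite avg; lra.
rewrite -[- eps]mul1r -sum1 mulr_suml !big_seq; apply: ler_sum => X Xs.
by rewrite ler_wpM2l// (fap_ge0 fP (CF X Xs)).
Qed.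
End AtomicCoherence.

Theorem theorem3 (R : realType) (Omega : Type) (C : set (set Omega))
    (P : set Omega -> R) (hC : field_of_sets C) :
  system3_coherent C P <->
  (countably_additive_probability C P /\
   exists F : set (set Omega), finite_atomic_partition C P F).
Proof.
split=> [coh|[hP aT]]; last exact: finitely_atomic_coherent.
have hP := coherent_countably_additive hC coh.
split=> //; apply: contrapT => nT.
have [B [CB PB tB]] := disjoint_positive_of_not_finitely_atomic hC hP.1 nT.
exact: (coherent_no_disjoint_positive coh CB PB tB).
Qed.
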